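(* Let $t\ge 2$ be an integer and let $L=b(t)$ be the Lie superalgebra of type $b(t)$ over a field of characteristic zero. Then $$exp(L)\le t^2-1+t\sqrt{t^2-1}.$$
   Context: $F$ is the ground field, of characteristic zero. The Lie superalgebra $b(t)$, $t\ge 2$, consists of the $2t\times 2t$ matrices $\begin{pmatrix} A & B\\ C & -A^T\end{pmatrix}$ with $A,B,C\in M_t(F)$, $B^T=B$, $C^T=-C$, $\mathrm{tr}\,A=0$, where $X\mapsto X^T$ is the transpose. Its even part $L_0$ consists of the matrices with $B=C=0$ ($|x|=0$ for $x\in L_0$), its odd part $L_1$ of the matrices with $A=0$ ($|x|=1$ for $x\in L_1$), and the product is given by $[x,y]=xy-(-1)^{|x||y|}yx$ for homogeneous $x,y$, extended bilinearly. Ordinary (non-graded) codimensions: regard $L$ as a (non-associative) algebra over $F$. Let $P_n$ be the space of multilinear polynomials in $x_1,\ldots,x_n$ in the free non-associative algebra over $F$, and let $Id(L)$ be the ideal of (ordinary, non-graded) polynomial identities of $L$. Then $c_n(L)=\dim\bigl(P_n/(P_n\cap Id(L))\bigr)$ and the (ordinary) PI-exponent is $exp(L)=\lim_{n\to\infty}\sqrt[n]{c_n(L)}$; the existence of this limit is taken from the earlier literature. *)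

(* Defs.v *)
From HB Require Import structures.
From mathcomp Require Import all_boot all_order all_algebra.
From mathcomp Require Import all_classical all_reals all_analysis.

Set Implicit Arguments.
Unset Strict Implicit.
Unset Printing Implicit Defensive.

Import Order.TTheory GRing.Theory Num.Theory.
Import numFieldNormedType.Exports.
Local Open Scope classical_set_scope.
Local Open Scope ring_scope.

(* Vector spaces with a bilinear, not necessarily associative, product. *)
HB.mixin Record Lmodule_isNaAlgebra (F : fieldType) A of GRing.Lmodule F A := {
  namul : A -> A -> A;
  namul_linearl : forall y : A, linear (namul^~ y);
  namul_linearr : forall x : A, linear (namul x)
}.

#[short(type="naAlgType")]
HB.structure Definition NaAlgebra (F : fieldType) :=
  {A of Lmodule_isNaAlgebra F A & GRing.Lmodule F A}.

(* Monomials: the free magma on the variables x_i, i : nat. *)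
Inductive namon := NaVar of nat | NaMul of namon & namon.

Fixpoint namon_tree (m : namon) : GenTree.tree nat :=
  match m with
  | NaVar i => GenTree.Leaf i
  | NaMul m1 m2 => GenTree.Node 0 [:: namon_tree m1; namon_tree m2]
  end.

Fixpoint tree_namon (u : GenTree.tree nat) : option namon :=
  match u with
  | GenTree.Leaf i => Some (NaVar i)
  | GenTree.Node _ [:: u1; u2] =>
      if (tree_namon u1, tree_namon u2) is (Some m1, Some m2)
      then Some (NaMul m1 m2) else None
  | _ => None
  end.

Lemma namon_treeK : pcancel namon_tree tree_namon.
Proof. by elim=> //= m1 -> m2 ->. Qed.

HB.instance Definition _ := Choice.copy namon (pcan_type namon_treeK).

Fixpoint naleaves (m : namon) : seq nat :=
  match m with
  | NaVar i => [:: i]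
  | NaMul m1 m2 => naleaves m1 ++ naleaves m2
  end.

(* The free non-associative algebra: finitely supported functions on the free
   magma, f m being the coefficient of the monomial m. *)
Definition nasupp (F : fieldType) (f : namon -> F^o) : set namon :=
  [set m | f m != 0].

Definition nafinsupp (F : fieldType) : {pred namon -> F^o} :=
  fun f => `[< finite_set (nasupp f) >].
Arguments nafinsupp : clear implicits.

Lemma nafinsupp_submod (F : fieldType) : submod_closed (nafinsupp F).
Proof.
split=> [|a f g /asboolP ff /asboolP fg]; apply/asboolP.
  rewrite (_ : nasupp _ = set0) //; apply/seteqP; split=> m //=.
  by rewrite /nasupp /= eqxx.
apply: (@sub_finite_set _ _ (nasupp f `|` nasupp g)); last first.
  by rewrite finite_setU.
move=> m; rewrite /nasupp /=.
case: (f m =P 0) => [fm0|fm0]; last by left; apply/eqP.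
by move=> h; right; move: h; rewrite !fctE fm0 /= scaler0 add0r.
Qed.

HB.instance Definition _ (F : fieldType) :=
  GRing.isSubmodClosed.Build F (namon -> F^o) (nafinsupp F) (nafinsupp_submod F).

Record naPoly (F : fieldType) :=
  NaPoly { nacoef :> namon -> F^o; _ : nacoef \in nafinsupp F }.

HB.instance Definition _ (F : fieldType) := [isSub for @nacoef F].
HB.instance Definition _ (F : fieldType) := [Choice of naPoly F by <:].
HB.instance Definition _ (F : fieldType) :=
  [SubChoice_isSubLmodule of naPoly F by <:].

Lemma finite_nasupp (F : fieldType) (f : naPoly F) : finite_set (nasupp f).
Proof. by have /asboolP := valP f. Qed.

Lemma finite_nasupp_seq (F : fieldType) (f : naPoly F) :
  exists r : seq namon, forall m, f m != 0 -> m \in r.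
Proof.
have /finite_seqP[r fr] := finite_nasupp f; exists r => m fm.
by have : nasupp f m by []; rewrite fr.
Qed.

Lemma nacoefE (F : fieldType) (a : F) (f g : naPoly F) (m : namon) :
  nacoef (a *: f + g) m = a * f m + g m.
Proof. by []. Qed.

Definition namon_prod (F : fieldType) (f g : namon -> F^o) : namon -> F^o :=
  fun m => if m is NaMul m1 m2 then f m1 * g m2 else 0.

Lemma namon_prod_fin (F : fieldType) (f g : naPoly F) :
  namon_prod f g \in nafinsupp F.
Proof.
apply/asboolP.
apply: (@sub_finite_set _ _ ((fun p => NaMul p.1 p.2) @`
   (nasupp f `*` nasupp g))).
  case=> [i|m1 m2]; rewrite /nasupp /= ?eqxx // mulf_eq0 negb_or => /andP[h1 h2].
  by exists (m1, m2).
by apply/finite_image/finite_setX; apply: finite_nasupp.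
Qed.

Definition napoly_mul (F : fieldType) (f g : naPoly F) : naPoly F :=
  NaPoly (namon_prod_fin f g).

Lemma napoly_mul_linearl (F : fieldType) (g : naPoly F) :
  linear (fun f => napoly_mul f g).
Proof.
move=> a f f'; apply/val_inj/funext => -[i|m1 m2] /=.
  by rewrite !fctE /= scaler0 addr0.
by rewrite !fctE /= mulrDl scalerAl.
Qed.

Lemma napoly_mul_linearr (F : fieldType) (f : naPoly F) :
  linear (napoly_mul f).
Proof.
move=> a g g'; apply/val_inj/funext => -[i|m1 m2] /=.
  by rewrite !fctE /= scaler0 addr0.
by rewrite !fctE /= mulrDr scalerAr.
Qed.

HB.instance Definition _ (F : fieldType) :=
  Lmodule_isNaAlgebra.Build F (naPoly F)
    (@napoly_mul_linearl F) (@napoly_mul_linearr F).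

Fixpoint namon_eval (F : fieldType) (A : naAlgType F) (v : nat -> A)
    (m : namon) : A :=
  match m with
  | NaVar i => v i
  | NaMul m1 m2 => namul (namon_eval v m1) (namon_eval v m2)
  end.

Definition naeval (F : fieldType) (A : naAlgType F) (v : nat -> A)
    (f : naPoly F) : A :=
  \sum_(m \in nasupp f) (f m : F) *: namon_eval v m.

Lemma naeval_seq (F : fieldType) (A : naAlgType F) (v : nat -> A)
    (f : naPoly F) (r : seq namon) :
  uniq r -> (forall m, f m != 0 -> m \in r) ->
  naeval v f = \sum_(m <- r) (f m : F) *: namon_eval v m.
Proof.
move=> ur sr; apply: fsbig_fwiden => //.
by move=> m [_ /negP]; rewrite negbK => /eqP /= ->; rewrite scale0r.
Qed.

Lemma naeval_linear (F : fieldType) (A : naAlgType F) (v : nat -> A) :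
  linear (naeval v).
Proof.
move=> a f g.
have [rf sf] := finite_nasupp_seq f; have [rg sg] := finite_nasupp_seq g.
pose r := undup (rf ++ rg).
have {}sf m : f m != 0 -> m \in r by rewrite mem_undup mem_cat => /sf ->.
have {}sg m : g m != 0 -> m \in r by rewrite mem_undup mem_cat orbC => /sg ->.
rewrite !(@naeval_seq _ _ _ _ r) ?undup_uniq //; last first.
  move=> m; apply: contraR => nr; rewrite nacoefE.
  have -> : nacoef f m = 0 by apply/eqP/(contraR _ nr)/sf.
  have -> : nacoef g m = 0 by apply/eqP/(contraR _ nr)/sg.
  by rewrite mulr0 addr0.
rewrite scaler_sumr -big_split /=; apply: eq_bigr => m _.
rewrite -[X in X *: _ = _]/(a * (f m : F) + (g m : F)).
by rewrite scalerDl scalerA.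
Qed.

Lemma naeval_var (F : fieldType) (A : naAlgType F) (v : nat -> A)
    (f : naPoly F) (i : nat) :
  (forall m, f m = (m == NaVar i)%:R) -> naeval v f = v i.
Proof.
move=> hf; rewrite (@naeval_seq _ _ _ _ [:: NaVar i]) //.
  by rewrite big_seq1 hf eqxx scale1r.
by move=> m; rewrite hf inE; case: (m == _); rewrite //= eqxx.
Qed.

Lemma naeval_mul (F : fieldType) (A : naAlgType F) (v : nat -> A)
    (f g : naPoly F) :
  naeval v (namul f g) = namul (naeval v f) (naeval v g).
Proof.
have linl (y : A) I (r : seq I) (c : I -> F) (e : I -> A) :
    namul (\sum_(i <- r) c i *: e i) y = \sum_(i <- r) c i *: namul (e i) y.
  elim: r => [|i r IH]; last by rewrite !big_cons (namul_linearl y) IH.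
  by rewrite !big_nil -[0 in LHS](addNr 0) -scaleN1r (namul_linearl y) scaleN1r addNr.
have linr (x : A) I (r : seq I) (c : I -> F) (e : I -> A) :
    namul x (\sum_(i <- r) c i *: e i) = \sum_(i <- r) c i *: namul x (e i).
  elim: r => [|i r IH]; last by rewrite !big_cons (namul_linearr x) IH.
  by rewrite !big_nil -[0 in LHS](addNr 0) -scaleN1r (namul_linearr x) scaleN1r addNr.
have [rf0 sf0] := finite_nasupp_seq f; have [rg0 sg0] := finite_nasupp_seq g.
pose rf := undup rf0; pose rg := undup rg0.
have sf m : f m != 0 -> m \in rf by rewrite mem_undup; exact: sf0.
have sg m : g m != 0 -> m \in rg by rewrite mem_undup; exact: sg0.
rewrite (@naeval_seq _ _ _ f rf) ?undup_uniq //.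
rewrite (@naeval_seq _ _ _ g rg) ?undup_uniq //.
rewrite (@naeval_seq _ _ _ _ [seq NaMul a b | a <- rf, b <- rg]).
- rewrite big_allpairs_dep linl; apply: eq_bigr => m1 _.
  rewrite linr scaler_sumr; apply: eq_bigr => m2 _.
  by rewrite scalerA.
- by apply: allpairs_uniq; rewrite ?undup_uniq // => -[a b] [c d] _ _ [-> ->].
- case=> [i|m1 m2]; first by rewrite /= eqxx.
  rewrite /= mulf_eq0 negb_or => /andP[h1 h2].
  by apply/allpairsP; exists (m1, m2); split; [exact: sf|exact: sg|].
Qed.

Definition naId (F : fieldType) (A : naAlgType F) : set (naPoly F) :=
  [set f | forall v : nat -> A, naeval v f = 0].

(* P_n: every monomial contains each of x_1, ..., x_n exactly once and no other
   variable. *)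
Definition multilin (F : fieldType) (n : nat) : set (naPoly F) :=
  [set f | forall m, f m != 0 -> perm_eq (naleaves m) (iota 1 n)].
Arguments multilin : clear implicits.

Definition basis_mod (F : fieldType) (V : lmodType F) (U W : set V) (k : nat)
    (e : 'I_k -> V) : Prop :=
  [/\ forall i, U (e i),
      forall a : 'I_k -> F, W (\sum_i a i *: e i) -> forall i, a i = 0
    & forall u, U u -> exists a : 'I_k -> F, W (u - \sum_i a i *: e i)].

(* The dimension of the quotient space U / (U `&` W); the default value 0
   stands for an infinite dimension. *)
Definition quot_dim (F : fieldType) (V : lmodType F) (U W : set V) : nat :=
  xget 0%N [set k | exists e : 'I_k -> V, basis_mod U W e].

Definition subspace (F : fieldType) (V : lmodType F) (W : set V) : Prop :=
  W 0 /\ forall (a : F) u v, W u -> W v -> W (a *: u + v).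

Lemma subspace_sum (F : fieldType) (V : lmodType F) (W : set V) (I : finType)
    (a : I -> F) (e : I -> V) :
  subspace W -> (forall i, W (e i)) -> W (\sum_i a i *: e i).
Proof.
move=> [W0 WL] We; elim/big_rec: _ => // i x _ Wx.
exact: WL.
Qed.

Lemma subspaceB (F : fieldType) (V : lmodType F) (W : set V) u v :
  subspace W -> W u -> W v -> W (u - v).
Proof. by move=> [_ WL] Wu Wv; rewrite addrC -scaleN1r; exact: WL. Qed.

Lemma basis_mod_le (F : fieldType) (V : lmodType F) (U W : set V) k k'
    (e : 'I_k -> V) (e' : 'I_k' -> V) :
  subspace W -> basis_mod U W e -> basis_mod U W e' -> (k' <= k)%N.
Proof.
move=> sW [_ _ sp] [Ue' fr' _]; rewrite leqNgt; apply/negP => ltk.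
have /choice[A hA] : forall j, exists a : 'I_k -> F, W (e' j - \sum_i a i *: e i).
  by move=> j; exact: sp.
pose M : 'M[F]_(k', k) := \matrix_(j, i) A j i.
have : kermx M != 0.
  rewrite kermx_eq0 /row_free; apply: contraTneq ltk => <-.
  by rewrite -leqNgt rank_leq_col.
case/rowV0Pn => x /sub_kermxP xM /eqP; apply; apply/rowP => j.
rewrite mxE; apply: (fr' (fun j => x 0 j)).
rewrite (_ : \sum_j _ = \sum_j x 0 j *: (e' j - \sum_i A j i *: e i)).
  exact: subspace_sum.
under [RHS]eq_bigr do rewrite scalerBr.
rewrite sumrB (_ : \sum_j x 0 j *: \sum_i _ = 0) ?subr0 //.
under eq_bigr do rewrite scaler_sumr.
rewrite exchange_big /= big1 // => i _.
under eq_bigr do rewrite scalerA.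
rewrite -scaler_suml (_ : \sum_j _ = 0) ?scale0r //.
have := congr1 (fun y : 'rV_k => y 0 i) xM; rewrite !mxE => xM0; rewrite -[RHS]xM0.
by apply: eq_bigr => j' _; rewrite mxE.
Qed.

Lemma quot_dimE (F : fieldType) (V : lmodType F) (U W : set V) k
    (e : 'I_k -> V) :
  subspace W -> basis_mod U W e -> quot_dim U W = k.
Proof.
move=> sW be; rewrite /quot_dim; case: xgetP => [k' _ [e' be']|/(_ k)[]].
  by apply/eqP; rewrite eqn_leq (basis_mod_le sW be be') (basis_mod_le sW be' be).
by exists e.
Qed.

Lemma basis_mod_exists (F : fieldType) (V : lmodType F) (U W : set V) N
    (s : 'I_N -> V) :
  subspace U -> subspace W -> (forall i, U (s i)) ->
  (forall u, U u -> exists a : 'I_N -> F, u = \sum_i a i *: s i) ->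
  exists k (e : 'I_k -> V), basis_mod U W e.
Proof.
move=> sU sW Us sp.
pose phi (a : 'rV[F]_N) := \sum_i a 0 i *: s i.
have phiL : linear phi.
  move=> c a b; rewrite /phi scaler_sumr -big_split /=; apply: eq_bigr => i _.
  by rewrite !mxE scalerDl scalerA.
have phi0 : phi 0 = 0 by rewrite /phi big1 // => i _; rewrite mxE scale0r.
pose P k := `[< exists S : {vspace 'rV[F]_N}, \dim S = k /\
                  forall a, a \in S -> W (phi a) >].
have exP : exists k, P k.
  exists 0%N; apply/asboolP; exists 0%VS; split; first by rewrite dimv0.
  by move=> a; rewrite memv0 => /eqP->; rewrite phi0; case: sW.
have ubP k : P k -> (k <= \dim {:'rV[F]_N})%N.
  by case/asboolP => S [<- _]; apply/dimvS/subvf.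
case: (ex_maxnP exP ubP) => k /asboolP[S [dS hS]] maxk.
have inS a : W (phi a) -> a \in S.
  move=> Wa; have : P (\dim (S + <[a]>)%VS).
    apply/asboolP; exists (S + <[a]>)%VS; split=> // b.
    case/memv_addP => x xS [y /vlineP[c ->] ->].
    by rewrite addrC phiL; apply sW.2 => //; apply: hS.
  move/maxk; rewrite -dS => le.
  have : (S == S + <[a]>)%VS by rewrite eqEdim addvSl.
  by move/eqP => ->; apply: (subvP (addvSr _ _)); exact: memv_line.
pose C := (S^C)%VS.
have SC0 : (S :&: C = 0)%VS by exact: capv_compl.
have phi_sum (a : 'I_(\dim C) -> F) :
    \sum_i a i *: phi (vbasis C)`_i = phi (\sum_i a i *: (vbasis C)`_i).
  elim/big_ind2 : _ => // [x1 x2 y1 y2 -> ->|i _].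
    have h p q : phi p + phi q = phi (p + q) by rewrite -[in RHS](scale1r p) phiL scale1r.
    exact: h.
  by rewrite -[in RHS](addr0 (_ *: _)) phiL phi0 addr0.
exists (\dim C), (fun i => phi (vbasis C)`_i); split=> [i|a|u /sp[a ->]].
- exact: subspace_sum.
- rewrite phi_sum => /inS xS i.
  have xC : \sum_i a i *: (vbasis C)`_i \in C.
    by apply: memv_suml => j _; apply/memvZ/vbasis_mem/mem_nth; rewrite size_tuple.
  have : \sum_i a i *: (vbasis C)`_i \in (S :&: C)%VS by rewrite memv_cap xS.
  rewrite SC0 memv0 => /eqP x0.
  have /freeP : free (vbasis C) by apply/basis_free/vbasisP.
  by apply.
- have : (\row_i a i) \in (S + C)%VS by rewrite addv_complf memvf.
  case/memv_addP => x xS [y yC xy]; exists (fun i => coord (vbasis C) i y).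
  rewrite phi_sum -(coord_vbasis yC).
  rewrite (_ : \sum_i _ = phi (\row_i a i)); last first.
    by apply: eq_bigr => i _; rewrite mxE.
  by rewrite xy -[x]scale1r phiL scale1r addrK; exact: hS.
Qed.

Lemma multilin_subspace (F : fieldType) n : subspace (multilin F n).
Proof.
split=> [m|a f g hf hg m]; first by rewrite eqxx.
rewrite nacoefE; have [->|fm0 _] := eqVneq (nacoef f m) 0; last exact: hf.
by rewrite mulr0 add0r; exact: hg.
Qed.

Lemma naId_subspace (F : fieldType) (A : naAlgType F) : subspace (naId A).
Proof.
split=> [v|a f g hf hg v].
  by rewrite (@naeval_seq _ _ _ _ [::]) ?big_nil // => m; rewrite eqxx.
by rewrite naeval_linear hf hg scaler0 addr0.
Qed.

Definition codim (F : fieldType) (A : naAlgType F) (n : nat) : nat :=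
  quot_dim (multilin F n) (multilin F n `&` naId A).

Lemma finite_multilin_mon n :
  finite_set [set m | perm_eq (naleaves m) (iota 1 n)].
Proof.
have size_gt0 m : (0 < size (naleaves m))%N.
  by elim: m => //= m1 h1 m2 h2; rewrite size_cat addn_gt0 h1.
pose T k := [set m | (size (naleaves m) <= k)%N /\
                     {subset naleaves m <= iota 1 n}].
have finT k : finite_set (T k).
  elim: k => [|k IH].
    rewrite (_ : T 0%N = set0) //; apply/seteqP; split=> m //= -[].
    by rewrite leqNgt size_gt0.
  apply: (@sub_finite_set _ _ ((NaVar @` [set` iota 1 n]) `|`
     ((fun p => NaMul p.1 p.2) @` (T k `*` T k)))); last first.
    rewrite finite_setU; split; apply: finite_image => //.
    exact: finite_setX.
  case=> [i [_ h]|m1 m2 [/= sz h]].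
    by left; exists i => //; apply: h; rewrite mem_head.
  move: sz; rewrite size_cat => sz.
  have s1 := size_gt0 m1; have s2 := size_gt0 m2.
  right; exists (m1, m2) => //; split; split=> /=.
  - by rewrite -ltnS (leq_trans _ sz) // -[X in (X < _)%N]addn0 ltn_add2l.
  - by move=> x xm; apply: h; rewrite mem_cat xm.
  - by rewrite -ltnS (leq_trans _ sz) // -[X in (X < _)%N]add0n ltn_add2r.
  - by move=> x xm; apply: h; rewrite mem_cat xm orbT.
apply: sub_finite_set (finT n) => m /= h; split.
  by rewrite (perm_size h) size_iota.
by move=> x; rewrite (perm_mem h).
Qed.

Lemma codim_basis (F : fieldType) (A : naAlgType F) (n : nat) :
  exists e : 'I_(codim A n) -> naPoly F,
    basis_mod (multilin F n) (multilin F n `&` naId A) e.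
Proof.
have sW : subspace (multilin F n `&` naId A).
  have [[h1 h2] [h3 h4]] := (multilin_subspace F n, naId_subspace A).
  by split=> // a u v [? ?] [? ?]; split; [exact: h2|exact: h4].
suff [k [e be]] : exists k (e : 'I_k -> naPoly F),
    basis_mod (multilin F n) (multilin F n `&` naId A) e.
  by rewrite /codim (quot_dimE sW be); exists e.
have /finite_seqP[r0 er0] := finite_multilin_mon n; pose r := undup r0.
have inr m : (m \in r) = perm_eq (naleaves m) (iota 1 n).
  rewrite mem_undup; have := congr1 (fun S : set namon => S m) er0.
  by move=> /= h; apply/idP/idP; rewrite h.
have delta_fin (m : namon) : (fun m' => (m' == m)%:R : F^o) \in nafinsupp F.
  apply/asboolP; apply: (@sub_finite_set _ _ [set m]) => // m'.
  rewrite /nasupp /=; case: (m' =P m) => // _ /negP[]; exact: eqxx.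
pose x0 := NaVar 0.
pose s (i : 'I_(size r)) := NaPoly (delta_fin (nth x0 r i)).
apply: (@basis_mod_exists _ _ _ _ _ s) => //.
- exact: multilin_subspace.
- move=> i m /=; rewrite /s /=.
  have [-> _|_] := eqVneq m (nth x0 r i); last by rewrite eqxx.
  by rewrite -inr mem_nth.
move=> u Uu; exists (fun i => u (nth x0 r i)); apply/val_inj/funext => m.
have -> : \val (\sum_(i < size r) (u (nth x0 r i) : F) *: s i) m =
          \sum_(i < size r) (u (nth x0 r i) : F) * (m == nth x0 r i)%:R.
  elim/big_ind2 : _ => // [f1 f2 g1 g2 <- <- //].
rewrite -(big_mkord xpredT (fun i => (u (nth x0 r i) : F) * (m == nth x0 r i)%:R)).
rewrite -(big_nth x0 xpredT (fun m' => (u m' : F) * (m == m')%:R)) /=.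
have [mr|mr] := boolP (m \in r).
  rewrite (bigD1_seq m) //= ?undup_uniq // eqxx mulr1 big1 ?addr0 // => m' ne.
  by rewrite eq_sym (negbTE ne) mulr0.
rewrite big_seq big1 => [|m' m'r].
  by apply/eqP; apply: contraR mr => um; rewrite inr; exact: Uu.
by case: eqP => [mm|]; rewrite ?mulr0 //; rewrite mm m'r in mr.
Qed.

Definition codim_root (R : realType) (F : fieldType) (A : naAlgType F)
    (n : nat) : R :=
  (codim A n)%:R `^ n%:R^-1.
Arguments codim_root : clear implicits.
Arguments codim_root R {F} A n.

(* limn returns a default value when the sequence has no limit, so a statement
   about PIexp R A is meaningful only when cvgn (codim_root R A) holds. *)
Definition PIexp (R : realType) (F : fieldType) (A : naAlgType F) : R :=
  limn (codim_root R A).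
Arguments PIexp : clear implicits.
Arguments PIexp R {F} A.

(* Homogeneous components, b = true being the odd one. *)
Definition super_part (F : fieldType) (t : nat) (b : bool)
    (x : 'M[F]_(t + t)) : 'M[F]_(t + t) :=
  if b then block_mx 0 (ursubmx x) (dlsubmx x) 0
  else block_mx (ulsubmx x) 0 0 (drsubmx x).

(* Bilinear extension of [x, y] = xy - (-1)^(|x||y|) yx, summing over the
   parities of the homogeneous components. *)
Definition super_bracket (F : fieldType) (t : nat) (x y : 'M[F]_(t + t)) :
    'M[F]_(t + t) :=
  \sum_(a : bool) \sum_(b : bool)
     (super_part a x *m super_part b y
      - (-1) ^+ (a && b) *: (super_part b y *m super_part a x)).

Definition in_bt (F : fieldType) (t : nat) : {pred 'M[F]_(t + t)} :=
  fun x => [&& drsubmx x == - (ulsubmx x)^T, (ursubmx x)^T == ursubmx x,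
               (dlsubmx x)^T == - dlsubmx x & \tr (ulsubmx x) == 0].
Arguments in_bt : clear implicits.

Lemma in_btP (F : fieldType) (t : nat) (x : 'M[F]_(t + t)) :
  reflect (exists A B C, [/\ x = block_mx A B C (- A^T), B^T = B, C^T = - C
                           & \tr A = 0]) (x \in in_bt F t).
Proof.
apply: (iffP and4P) => [[/eqP h1 /eqP h2 /eqP h3 /eqP h4]|[A [B [C []]]]].
  by exists (ulsubmx x), (ursubmx x), (dlsubmx x); rewrite -h1 submxK.
move=> -> hB hC hA; rewrite block_mxKdr block_mxKul block_mxKur block_mxKdl.
by split; apply/eqP.
Qed.

Lemma in_bt_submod (F : fieldType) (t : nat) : submod_closed (in_bt F t).
Proof.
split=> [|a x y /in_btP[A [B [C [-> hB hC hA]]]] /in_btP[A' [B' [C' [-> hB' hC' hA']]]]].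
  by apply/in_btP; exists 0, 0, 0; rewrite !trmx0 oppr0 mxtrace0 block_mx0.
apply/in_btP; exists (a *: A + A'), (a *: B + B'), (a *: C + C').
rewrite scale_block_mx add_block_mx !linearD !linearZ /= hB hC hA hB' hC' hA'.
by rewrite !scalerN -!opprD mulr0 addr0.
Qed.

HB.instance Definition _ (F : fieldType) (t : nat) :=
  GRing.isSubmodClosed.Build F 'M[F]_(t + t) (in_bt F t) (@in_bt_submod F t).

Lemma super_bracket_block (F : fieldType) (t : nat)
    (A B C D A' B' C' D' : 'M[F]_t) :
  super_bracket (block_mx A B C D) (block_mx A' B' C' D') =
  block_mx (A *m A' - A' *m A + (B *m C' + B' *m C))
           (A *m B' - B' *m D + (B *m D' - A' *m B))
           (D *m C' - C' *m A + (C *m A' - D' *m C))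
           (D *m D' - D' *m D + (C *m B' + C' *m B)).
Proof.
rewrite /super_bracket !big_bool /= /super_part /=.
rewrite !block_mxKdr !block_mxKul !block_mxKur !block_mxKdl !mulmx_block.
rewrite !(mul0mx, mulmx0, addr0, add0r) !scale_block_mx !opp_block_mx.
rewrite !add_block_mx expr1 expr0 !(scaler0, oppr0, addr0, add0r, scale1r).
rewrite !scaleN1r !opprK.
by congr block_mx; rewrite addrC.
Qed.


Lemma super_bracket_bt (F : fieldType) (t : nat) (x y : 'M[F]_(t + t)) :
  [pchar F] =i pred0 -> x \in in_bt F t -> y \in in_bt F t ->
  super_bracket x y \in in_bt F t.
Proof.
move=> charF /in_btP[A [B [C [-> hB hC hA]]]] /in_btP[A' [B' [C' [-> hB' hC' hA']]]].
have trBC (S K : 'M[F]_t) : S^T = S -> K^T = - K -> \tr (S *m K) = 0.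
  move=> hS hK; have : \tr (S *m K) = - \tr (S *m K).
    by rewrite -{1}mxtrace_tr trmx_mul hS hK mulNmx linearN /= mxtrace_mulC.
  move/eqP; rewrite -addr_eq0 -mulr2n -mulr_natr mulf_eq0.
  by rewrite ((pcharf0P F).1 charF) orbF => /eqP.
apply/in_btP; rewrite super_bracket_block.
exists (A *m A' - A' *m A + (B *m C' + B' *m C)).
exists (A *m B' - B' *m (- A^T) + (B *m (- A'^T) - A' *m B)).
exists (- A^T *m C' - C' *m A + (C *m A' - (- A'^T) *m C)).
split.
- congr block_mx; rewrite !linearD !linearN /= !trmx_mul hB hC hB' hC'.
  rewrite !(mulNmx, mulmxN, opprK, opprD).
  by congr (_ + _); rewrite addrC.
- rewrite !(mulmxN, opprK) !linearD !linearN /= !trmx_mul hB hB' !trmxK.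
  by congr (_ + _); rewrite addrC.
- rewrite !(mulNmx, opprK) !linearD !linearN /= !trmx_mul hC hC' !trmxK.
  rewrite !(mulNmx, mulmxN, opprK, opprD).
  by congr (_ + _); rewrite addrC.
- by rewrite !linearD linearN /= mxtrace_mulC subrr !trBC // !addr0.
Qed.

Lemma super_part_linear (F : fieldType) (t : nat) (b : bool) :
  linear (@super_part F t b).
Proof.
move=> a x y.
rewrite -{1}(submxK x) -{1}(submxK y) scale_block_mx add_block_mx /super_part.
rewrite block_mxKdr block_mxKul block_mxKur block_mxKdl.
by case: b; rewrite scale_block_mx add_block_mx !(scaler0, addr0).
Qed.

Lemma super_bracket_linearl (F : fieldType) (t : nat) (y : 'M[F]_(t + t)) :
  linear (fun x => super_bracket x y).
Proof.
move=> a x x'; rewrite /super_bracket scaler_sumr -big_split /=.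
apply: eq_bigr => b _; rewrite scaler_sumr -big_split /=; apply: eq_bigr => c _.
rewrite super_part_linear mulmxDl mulmxDr -scalemxAl -scalemxAr scalerDr.
by rewrite scalerA (mulrC _ a) -scalerA scalerBr opprD addrACA.
Qed.

Lemma super_bracket_linearr (F : fieldType) (t : nat) (x : 'M[F]_(t + t)) :
  linear (super_bracket x).
Proof.
move=> a y y'; rewrite /super_bracket scaler_sumr -big_split /=.
apply: eq_bigr => b _; rewrite scaler_sumr -big_split /=; apply: eq_bigr => c _.
rewrite super_part_linear mulmxDl mulmxDr -scalemxAl -scalemxAr scalerDr.
by rewrite scalerA (mulrC _ a) -scalerA scalerBr opprD addrACA.
Qed.

(* The proof of characteristic zero is a parameter because closure under the
   bracket fails in characteristic 2. *)
Record bt (F : fieldType) (charF : [pchar F] =i pred0) (t : nat) :=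
  Bt { bt_mx :> 'M[F]_(t + t); _ : bt_mx \in in_bt F t }.

HB.instance Definition _ F charF t := [isSub for @bt_mx F charF t].
HB.instance Definition _ F charF t := [Choice of @bt F charF t by <:].
HB.instance Definition _ F charF t :=
  [SubChoice_isSubLmodule of @bt F charF t by <:].

Definition bt_bracket F charF t (x y : @bt F charF t) : @bt F charF t :=
  Bt charF (super_bracket_bt charF (valP x) (valP y)).

Lemma bt_bracket_linearl F charF t (y : @bt F charF t) :
  linear (fun x => bt_bracket x y).
Proof. by move=> a x x'; apply: val_inj; exact: super_bracket_linearl. Qed.

Lemma bt_bracket_linearr F charF t (x : @bt F charF t) :
  linear (bt_bracket x).
Proof. by move=> a y y'; apply: val_inj; exact: super_bracket_linearr. Qed.

HB.instance Definition _ F charF t :=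
  Lmodule_isNaAlgebra.Build F (@bt F charF t)
    (@bt_bracket_linearl F charF t) (@bt_bracket_linearr F charF t).

(* Main.v *)
(* b(t) is Z-graded: the blocks B, A, C have degrees 1, 0, -1 and dimensions
   r = t(t+1)/2, q = t^2-1, p = t(t-1)/2.  Modulo identities, a multilinear
   polynomial is determined by the coordinates of its values on tuples of
   homogeneous basis elements, and such a coordinate vanishes unless its degree
   is the sum of the degrees in the tuple.  Giving degree d the weight z^d, the
   number of remaining (tuple, coordinate) pairs is at most
   K(z) (r z + q + p / z)^n for each z > 0; the minimum over z of the base is
   q + 2 sqrt(p r) = t^2 - 1 + t sqrt(t^2 - 1). *)
Require Import Defs.
From mathcomp Require Import all_boot all_order all_algebra.
From mathcomp Require Import all_classical all_reals all_analysis.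
From mathcomp Require Import ring lra.

Set Implicit Arguments.
Unset Strict Implicit.
Unset Printing Implicit Defensive.

Import Order.TTheory GRing.Theory Num.Theory.
Import numFieldNormedType.Exports.
Local Open Scope classical_set_scope.
Local Open Scope ring_scope.

(** * Multilinear polynomials and their values on a spanning family *)

Lemma namul_suml (F : fieldType) (A : naAlgType F) (y : A) (I : finType)
    (c : I -> F) (e : I -> A) :
  namul (\sum_i c i *: e i) y = \sum_i c i *: namul (e i) y.
Proof.
elim: (index_enum I) => [|i r IH]; last first.
  by rewrite !big_cons (namul_linearl y) IH.
by rewrite !big_nil -[0 in LHS](addNr 0) -scaleN1r (namul_linearl y) scaleN1r addNr.
Qed.

Lemma namul_sumr (F : fieldType) (A : naAlgType F) (x : A) (I : finType)
    (c : I -> F) (e : I -> A) :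
  namul x (\sum_i c i *: e i) = \sum_i c i *: namul x (e i).
Proof.
elim: (index_enum I) => [|i r IH]; last first.
  by rewrite !big_cons (namul_linearr x) IH.
by rewrite !big_nil -[0 in LHS](addNr 0) -scaleN1r (namul_linearr x) scaleN1r addNr.
Qed.

Lemma eq_namon_eval (F : fieldType) (A : naAlgType F) (v w : nat -> A)
    (m : namon) :
  {in naleaves m, v =1 w} -> namon_eval v m = namon_eval w m.
Proof.
elim: m => [i|m1 IH1 m2 IH2] /= vw; first by apply: vw; rewrite inE.
by rewrite IH1 ?IH2 // => k km; apply: vw; rewrite mem_cat km ?orbT.
Qed.

(** A variable occurring once in a product lies in exactly one factor; the other factor does not see
    its value, and [namul] is linear in each argument. *)
Lemma namon_eval_sum (F : fieldType) (A : naAlgType F) (v : nat -> A)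
    (m : namon) (i : nat) (I : finType) (c : I -> F) (b : I -> A) :
  count_mem i (naleaves m) = 1%N ->
  namon_eval [eta v with i |-> \sum_j c j *: b j] m =
  \sum_j c j *: namon_eval [eta v with i |-> b j] m.
Proof.
have notin m' x : count_mem i (naleaves m') = 0%N ->
    namon_eval [eta v with i |-> x] m' = namon_eval v m'.
  move=> c0; apply: eq_namon_eval => k km /=; case: eqP => // ki.
  by move: c0; rewrite -ki => /count_memPn; rewrite km.
elim: m => [k|m1 IH1 m2 IH2] /=.
  by case: eqP.
rewrite count_cat; case E1: (count_mem i (naleaves m1)) => [|[|n1]] //.
  rewrite add0n => E2; rewrite IH2 // namul_sumr.
  by apply: eq_bigr => j _; rewrite !(notin m1).
case E2: (count_mem i (naleaves m2)) => // _; rewrite IH1 // namul_suml.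
by apply: eq_bigr => j _; rewrite !(notin m2).
Qed.

Section Multilinear.
Variables (F : fieldType) (A : naAlgType F) (n : nat) (f : naPoly F).
Hypothesis f_multilin : multilin F n f.

(** One list of monomials serves every [v], so evaluations at different valuations can be compared
    term by term. *)
Lemma naeval_multilinE : exists r : seq namon,
  (forall m, m \in r -> perm_eq (naleaves m) (iota 1 n)) /\
  forall v : nat -> A, naeval v f = \sum_(m <- r) (f m : F) *: namon_eval v m.
Proof.
have [r0 r0P] := finite_nasupp_seq f.
exists (undup [seq m <- r0 | f m != 0]); split=> [m|v].
  by rewrite mem_undup mem_filter => /andP[/f_multilin].
apply: naeval_seq; first exact: undup_uniq.
by move=> m fm; rewrite mem_undup mem_filter fm r0P.
Qed.

Lemma eq_naeval (v w : nat -> A) :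
  {in iota 1 n, v =1 w} -> naeval v f = naeval w f.
Proof.
have [r [rP E]] := naeval_multilinE.
move=> vw; rewrite !E; apply: eq_big_seq => m /rP mP.
by congr (_ *: _); apply: eq_namon_eval => k; rewrite (perm_mem mP) => /vw.
Qed.

Lemma naeval_sum_var (v : nat -> A) (i : nat) (I : finType) (c : I -> F)
    (b : I -> A) :
  i \in iota 1 n ->
  naeval [eta v with i |-> \sum_j c j *: b j] f =
  \sum_j c j *: naeval [eta v with i |-> b j] f.
Proof.
have [r [rP E]] := naeval_multilinE => i_n.
rewrite E; under [RHS]eq_bigr do rewrite E scaler_sumr.
rewrite exchange_big /=; apply: eq_big_seq => m /rP mP.
rewrite namon_eval_sum; last first.
  by rewrite (permP mP) count_uniq_mem ?iota_uniq // i_n.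
by rewrite scaler_sumr; apply: eq_bigr => j _; rewrite !scalerA mulrC.
Qed.

(* P_n uses the variables x_1, ..., x_n, while 'I_n starts at 0. *)
Definition valuation (x : 'I_n -> A) (i : nat) : A := oapp x 0 (insub i.-1).

Lemma valuationS (x : 'I_n -> A) (k : 'I_n) : valuation x k.+1 = x k.
Proof. by rewrite /valuation /= valK. Qed.

Lemma naId_basis (I : finType) (b : I -> A) :
  (forall x : A, exists c : I -> F, x = \sum_i c i *: b i) ->
  (forall phi : {ffun 'I_n -> I}, naeval (valuation (b \o phi)) f = 0) ->
  naId A f.
Proof.
move=> bP phi0 v.
(* Induction on k, the number of leading variables whose values may be arbitrary: [k = n] is the
   claim, [k = 0] is the hypothesis [phi0], and passing from k to k+1 expands the value of
   x_(k+1). *)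
suff step k (w : nat -> A) :
    (forall i, i \in iota 1 n -> (k < i)%N -> exists j, w i = b j) ->
    naeval w f = 0.
  apply: (step n) => i; rewrite mem_iota addnC addn1 ltnS => /andP[_ le_in].
  by rewrite ltnNge le_in.
elim: k w => [|k IH] w wb.
  have /fin_all_exists[phi phiP] (i : 'I_n) : exists j, w i.+1 = b j.
    by apply: wb; rewrite // mem_iota add1n /= ltnS ltn_ord.
  rewrite -(phi0 [ffun i => phi i]); apply: eq_naeval => -[|i].
    by rewrite mem_iota.
  rewrite mem_iota add1n /= ltnS => i_n.
  by rewrite (valuationS _ (Ordinal i_n)) /= ffunE -phiP.
have [k_n|k_n] := boolP (k.+1 \in iota 1 n); last first.
  apply: IH => i i_n; rewrite leq_eqVlt => /predU1P[ki|]; last exact: wb.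
  by move: i_n k_n; rewrite ki => ->.
have [c wk] := bP (w k.+1).
rewrite (@eq_naeval _ [eta w with k.+1 |-> \sum_j c j *: b j]); last first.
  by move=> i _ /=; case: eqP => // ->.
rewrite naeval_sum_var // big1 // => j _; rewrite IH ?scaler0 // => i i_n ki /=.
have [_|ne] := eqVneq i k.+1; first by exists j.
by apply: wb => //; rewrite ltn_neqAle eq_sym ne.
Qed.

End Multilinear.

(** * Codimension bounds for graded algebras *)

Lemma leq_card_free (F : fieldType) (k : nat) (T : finType) (P : {pred T})
    (M : 'I_k -> T -> F) :
  (forall i s, s \notin P -> M i s = 0) ->
  (forall a : 'I_k -> F, (forall s, \sum_i a i * M i s = 0) ->
     forall i, a i = 0) ->
  (k <= #|P|)%N.
Proof.
move=> MP Mfree; rewrite leqNgt; apply/negP => lt_Pk.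
(* If k exceeded the number of columns in P, this submatrix would have a nonzero left kernel vector;
   the corresponding combination of rows vanishes on P, and off P by [MP]. *)
pose N : 'M[F]_(k, #|P|) := \matrix_(i, s) M i (enum_val s).
have : kermx N != 0.
  rewrite kermx_eq0 /row_free; apply: contraTneq lt_Pk => <-.
  by rewrite -leqNgt rank_leq_col.
case/rowV0Pn => x /sub_kermxP xN /eqP; apply; apply/rowP => i.
rewrite mxE; apply: (Mfree (fun i => x 0 i)) => s.
have [sP|sP] := boolP (s \in P); last first.
  by rewrite big1 // => i' _; rewrite MP // mulr0.
have := congr1 (fun y : 'rV_#|P| => y 0 (enum_rank_in sP s)) xN.
rewrite !mxE => xN0; rewrite -[RHS]xN0; apply: eq_bigr => i' _.
by rewrite mxE enum_rankK_in.
Qed.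

Section GradedBound.
Variables (F : fieldType) (A : naAlgType F) (I J : finType).
Variables (b : I -> A) (degb : I -> int) (coor : J -> A -> F) (degc : J -> int).

(** The functionals [coor j] separate points but may be linearly dependent; for b(t) they are all 4
    t^2 matrix entries. *)
Definition homog (d : int) (x : A) : Prop :=
  forall j, degc j != d -> coor j x = 0.

Hypothesis b_span : forall x, exists c : I -> F, x = \sum_i c i *: b i.
Hypothesis coor_lin : forall j, linear (coor j : A -> F^o).
Hypothesis coor_inj : forall x, (forall j, coor j x = 0) -> x = 0.
Hypothesis homog_b : forall i, homog (degb i) (b i).
Hypothesis homog_mul : forall d e x y,
  homog d x -> homog e y -> homog (d + e) (namul x y).

Lemma coor_sum j (T : Type) (r : seq T) (c : T -> F) (x : T -> A) :
  coor j (\sum_(i <- r) c i *: x i) = \sum_(i <- r) c i * coor j (x i).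
Proof.
elim: r => [|i r IH]; last by rewrite !big_cons coor_lin IH.
rewrite !big_nil -[0 in LHS](addNr 0) -scaleN1r coor_lin.
by rewrite scaleN1r addNr.
Qed.

Lemma homog_eval (v : nat -> A) (d : nat -> int) (m : namon) :
  (forall i, i \in naleaves m -> homog (d i) (v i)) ->
  homog (\sum_(i <- naleaves m) d i) (namon_eval v m).
Proof.
elim: m => [i|m1 IH1 m2 IH2] /= vd; first by rewrite big_seq1; apply: vd; rewrite inE.
rewrite big_cat /=; apply: homog_mul; [apply: IH1|apply: IH2] => i im;
  by apply: vd; rewrite mem_cat im ?orbT.
Qed.

Lemma homog_naeval n (f : naPoly F) (phi : 'I_n -> I) :
  multilin F n f ->
  homog (\sum_k degb (phi k)) (naeval (valuation (b \o phi)) f).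
Proof.
move=> fn j ne; have [r [rP ->]] := naeval_multilinE A fn.
rewrite coor_sum big1_seq // => m /= /rP mP.
(* The degree of the vector substituted for x_i, with the same index shift as in [valuation]. *)
pose d i := oapp (degb \o phi) 0 (insub i.-1 : option 'I_n).
rewrite (@homog_eval _ d _ _ j) ?mulr0 // => [i|].
  rewrite (perm_mem mP) mem_iota add1n; case: i => //= i; rewrite ltnS => i_n.
  rewrite (valuationS (b \o phi) (Ordinal i_n)) /d /= insubT /=.
  exact: homog_b.
rewrite (perm_big _ mP) /= (iotaDl 1 0) big_map.
rewrite -[X in iota 0 X]subn0 big_mkord (eq_bigr (fun k => degb (phi k))) //.
by move=> k _; rewrite /d /= valK.
Qed.

(** Take polynomials representing a basis of the quotient. The coordinates of their values form a
    matrix with independent rows, since a combination vanishing in all coordinates on all basis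
    tuples is an identity. By homogeneity only the columns counted here can be nonzero. *)
Lemma codim_le_card n :
  (codim A n <= #|[pred p : {ffun 'I_n -> I} * J |
                    (\sum_k degb (p.1 k) == degc p.2)%R]|)%N.
Proof.
have [e [e_ml e_free _]] := codim_basis A n.
pose M i (p : {ffun 'I_n -> I} * J) :=
  coor p.2 (naeval (valuation (b \o p.1)) (e i)).
apply: (@leq_card_free F _ _ _ M) => [i p|a aM].
  rewrite inE eq_sym => ne; exact: homog_naeval.
apply: e_free; split; first exact: subspace_sum (multilin_subspace F n) _.
apply: (@naId_basis F A n _ _ I b) => //.
  exact: subspace_sum (multilin_subspace F n) _.
move=> phi; apply: coor_inj => j; rewrite -[RHS](aM (phi, j)) /M /=.
have -> : naeval (valuation (b \o phi)) (\sum_i a i *: e i) =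
    \sum_i a i *: naeval (valuation (b \o phi)) (e i).
  elim: (index_enum _) => [|i r IH]; last by rewrite !big_cons naeval_linear IH.
  rewrite !big_nil -[0 in LHS](addNr 0) -scaleN1r naeval_linear.
  by rewrite scaleN1r addNr.
exact: coor_sum.
Qed.

(** Each counted pair (phi, j) has weight z^(deg phi - deg j) = 1 and every other pair has
    nonnegative weight, so the count is at most the total weight, which factors. *)
Lemma codim_le_expr (R : realType) (z : R) n : 0 < z ->
  (codim A n)%:R <= (\sum_j z ^ (- degc j)) * (\sum_i z ^ degb i) ^+ n.
Proof.
move=> z0; have zn0 : z != 0 by rewrite gt_eqF.
have -> : (\sum_i z ^ degb i) ^+ n =
    \sum_(phi : {ffun 'I_n -> I}) z ^ (\sum_k degb (phi k)).
  rewrite -[in LHS](card_ord n) -prodr_const bigA_distr_bigA /=.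
  apply: eq_bigr => phi _; symmetry.
  exact: (big_morph (exprz z) (fun d e => expfzDr d e zn0) (expr0z z)).
rewrite mulr_sumr.
under eq_bigr do rewrite mulr_suml.
rewrite pair_big /=.
apply: (@le_trans _ _ (#|[pred p : {ffun 'I_n -> I} * J |
                    \sum_k degb (p.1 k) == degc p.2]|)%:R).
  by rewrite ler_nat codim_le_card.
rewrite -sum1_card natr_sum big_mkcond /=; apply: ler_sum => p _.
case: ifP => [|_]; last by rewrite mulr_ge0 // exprz_ge0 // ltW.
by rewrite inE => /eqP ->; rewrite -expfzDr // addNr expr0z.
Qed.

End GradedBound.

(** * From codimension bounds to the exponent *)

Lemma PIexp_le (R : realType) (F : fieldType) (A : naAlgType F) (K l : R) :
  0 < K -> 0 <= l -> (forall n, (codim A n)%:R <= K * l ^+ n) ->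
  cvgn (codim_root R A) -> PIexp R A <= l.
Proof.
move=> K0 l0 cK cvgA.
(* [g n] is the (n+1)-th root of K l^(n+1), with the root of K written as an exponential whose
   argument tends to 0. *)
pose g (n : nat) : R := expR (n.+1%:R^-1 * ln K) * l.
have cvg_g : g @ \oo --> l.
  rewrite -[X in _ --> X]mul1r; apply: cvgMl.
  rewrite -[X in _ --> X]expR0; apply: continuous_cvg; first exact: continuous_expR.
  rewrite -[X in _ --> X](mul0r (ln K)); apply: cvgMl; exact: cvg_harmonic.
(* The shift skips n = 0, where the exponent 1/n is 0 by convention and the root of l^n need not be
   l. *)
have cvgS : (fun n => codim_root R A n.+1) @ \oo --> PIexp R A.
  by rewrite (cvg_shiftS (codim_root R A)).
apply: (ler_cvg_to cvgS cvg_g); apply: nearW => n.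
rewrite /codim_root; apply: (@le_trans _ _ ((K * l ^+ n.+1) `^ n.+1%:R^-1)).
  by apply: ge0_ler_powR; rewrite ?nnegrE ?invr_ge0 // mulr_ge0 ?exprn_ge0 // ltW.
rewrite powRM ?exprn_ge0 ?(ltW K0) // -powR_mulrn // -powRrM divff ?pnatr_eq0 //.
by rewrite powRr1 // /g -{1}(lnK K0) -expRM (mulrC (ln K)).
Qed.

(** * The grading of block matrices *)

Definition entry_deg (t : nat) (p : 'I_(t + t) * 'I_(t + t)) : int :=
  (t <= p.2)%N%:Z - (t <= p.1)%N%:Z.

Definition mx_homog (F : fieldType) (t : nat) (d : int) (x : 'M[F]_(t + t)) :=
  forall i j, entry_deg (i, j) != d -> x i j = 0.

(** The degree of an entry is its column label minus its row label, so the label of the intermediate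
    index cancels in a product. *)
Lemma mx_homog_mul (F : fieldType) (t : nat) (d e : int)
    (x y : 'M[F]_(t + t)) :
  mx_homog d x -> mx_homog e y -> mx_homog (d + e) (x *m y).
Proof.
move=> xd ye i j; rewrite mxE => ne; rewrite big1 // => k _.
have [dE|/xd->] := eqVneq (entry_deg (i, k)) d; last by rewrite mul0r.
rewrite ye ?mulr0 //; apply: contraNneq ne => eE.
by apply/eqP; rewrite -dE -eE /entry_deg /= [RHS]addrC addrA subrK.
Qed.

Lemma mx_homog_super_part (F : fieldType) (t : nat) (a : bool) (d : int)
    (x : 'M[F]_(t + t)) : mx_homog d x -> mx_homog d (super_part a x).
Proof.
move=> xd i j /xd xij; rewrite /super_part -[x in LHS]submxK.
rewrite block_mxKdr block_mxKul block_mxKur block_mxKdl.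
case: a; case: (split_ordP i) xij => i' ->; case: (split_ordP j) => j' ->;
  by rewrite ?block_mxEul ?block_mxEur ?block_mxEdl ?block_mxEdr ?mxE.
Qed.

Lemma mx_homog_bracket (F : fieldType) (t : nat) (d e : int)
    (x y : 'M[F]_(t + t)) :
  mx_homog d x -> mx_homog e y -> mx_homog (d + e) (super_bracket x y).
Proof.
move=> xd ye i j ne; rewrite /super_bracket summxE big1 // => a _.
rewrite summxE big1 // => b _; rewrite !mxE.
have := mx_homog_mul (mx_homog_super_part a xd) (mx_homog_super_part b ye) ne.
rewrite addrC in ne.
have := mx_homog_mul (mx_homog_super_part b ye) (mx_homog_super_part a xd) ne.
by rewrite !mxE => -> ->; rewrite mulr0 subr0.
Qed.

Lemma mx_homog_block (F : fieldType) (t : nat) (A B C D : 'M[F]_t) (d : int) :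
  (d != 0 -> A = 0 /\ D = 0) -> (d != 1 -> B = 0) -> (d != -1 -> C = 0) ->
  mx_homog d (block_mx A B C D).
Proof.
move=> AD0 B0 C0 i j; rewrite /entry_deg /=.
case: (split_ordP i) => i' ->; case: (split_ordP j) => j' -> /=;
  rewrite ?leq_addr ?[(t <= _)%N]leqNgt ?ltn_ord /= ?subrr ?subr0 ?sub0r
    eq_sym => ne.
- by rewrite block_mxEul (AD0 ne).1 mxE.
- by rewrite block_mxEur B0 // mxE.
- by rewrite block_mxEdl C0 // mxE.
- by rewrite block_mxEdr (AD0 ne).2 mxE.
Qed.

Lemma sum_block_mx (F : fieldType) (t : nat) (I : finType) (c : I -> F)
    (A B C D : I -> 'M[F]_t) :
  \sum_i c i *: block_mx (A i) (B i) (C i) (D i) =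
  block_mx (\sum_i c i *: A i) (\sum_i c i *: B i)
           (\sum_i c i *: C i) (\sum_i c i *: D i).
Proof.
elim: (index_enum I) => [|i r IH]; first by rewrite !big_nil block_mx0.
by rewrite !big_cons IH scale_block_mx add_block_mx.
Qed.

(** * Spanning families of symmetric, skew-symmetric and traceless matrices *)

Section SpanningMatrices.
Variables (F : fieldType) (t : nat).

(** The disjunction yields E_ii rather than 2 E_ii on the diagonal. Pairs with i > j give 0, so that
    they can index the skew matrices instead. *)
Definition sym_mx (p : 'I_t * 'I_t) : 'M[F]_t :=
  if (p.1 <= p.2)%N
  then \matrix_(k, l) (((k, l) == p) || ((l, k) == p))%:R else 0.

Definition skew_mx (p : 'I_t * 'I_t) : 'M[F]_t :=
  if (p.1 <= p.2)%N then 0 else delta_mx p.1 p.2 - delta_mx p.2 p.1.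

Definition sl_mx (i0 : 'I_t) (p : 'I_t * 'I_t) : 'M[F]_t :=
  delta_mx p.1 p.2 - (p.1 == p.2)%:R *: delta_mx i0 i0.

Lemma sym_mx_tr p : (sym_mx p)^T = sym_mx p.
Proof.
rewrite /sym_mx; case: ifP => _; last exact: trmx0.
by apply/matrixP => k l; rewrite !mxE orbC.
Qed.

Lemma skew_mx_tr p : (skew_mx p)^T = - skew_mx p.
Proof.
rewrite /skew_mx; case: ifP => _; first by rewrite trmx0 oppr0.
by rewrite linearB /= !trmx_delta opprB.
Qed.

Lemma sl_mx_tr i0 p : \tr (sl_mx i0 p) = 0.
Proof.
have trE (i j : 'I_t) : \tr (delta_mx i j : 'M[F]_t) = (i == j)%:R.
  rewrite /mxtrace (bigD1 i) //= big1 => [|k ki]; last first.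
    by rewrite mxE (negPf ki).
  by rewrite mxE eqxx addr0.
by rewrite /sl_mx linearB linearZ /= !trE eqxx mulr1 subrr.
Qed.

Lemma sym_mx_span (B : 'M[F]_t) :
  B^T = B -> \sum_p B p.1 p.2 *: sym_mx p = B.
Proof.
move=> Bsym; apply/matrixP => k l; rewrite summxE.
have Bkl : B l k = B k l by rewrite -{1}Bsym mxE.
(* The only index whose matrix can have a nonzero (k, l) entry. *)
pose q := if (k <= l)%N then (k, l) else (l, k).
rewrite (bigD1 q) //= big1 => [|p pq].
  rewrite addr0 mxE /sym_mx /q; have [kl|/ltnW kl] := leqP k l.
    by rewrite /= kl mxE eqxx mulr1.
  by rewrite /= kl mxE eqxx orbT mulr1 Bkl.
rewrite mxE /sym_mx; case: ifP => p12; last by rewrite mxE mulr0.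
rewrite mxE; case: eqP => [pE|_].
  by move: pq p12; rewrite -pE /q /= => + kl; rewrite kl eqxx.
case: eqP => [pE|_]; last by rewrite mulr0.
move: pq p12; rewrite -pE /q /= => + lk; case: (leqP k l) => kl; last first.
  by rewrite eqxx.
have -> : k = l by apply/val_inj/eqP; rewrite /= eqn_leq kl.
by rewrite eqxx.
Qed.

Lemma skew_mx_span (C : 'M[F]_t) : [pchar F] =i pred0 ->
  C^T = - C -> \sum_p C p.1 p.2 *: skew_mx p = C.
Proof.
move=> charF Cskew; apply/matrixP => k l; rewrite summxE.
have Ckl i j : C j i = - C i j.
  by have := congr1 (fun M : 'M[F]_t => M i j) Cskew; rewrite !mxE.
have Ckk i : C i i = 0.
  move/eqP: (Ckl i i); rewrite -addr_eq0 -mulr2n -mulr_natr mulf_eq0.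
  by rewrite ((pcharf0P F).1 charF) orbF => /eqP.
have skewE (p : 'I_t * 'I_t) i j : ~~ (p.1 <= p.2)%N ->
    skew_mx p i j = ((i, j) == p)%:R - ((j, i) == p)%:R.
  case: p => p1 p2 /= /negPf p12; rewrite /skew_mx /= p12 !mxE.
  by rewrite !xpair_eqE (andbC (j == p1)).
have skew0 (p : 'I_t * 'I_t) i j : (p.1 <= p.2)%N -> skew_mx p i j = 0.
  by move=> p12; rewrite /skew_mx p12 mxE.
(* Nonzero skew matrices are indexed by [p.1 > p.2], so here the larger index comes first. *)
pose q := if (k <= l)%N then (l, k) else (k, l).
rewrite (bigD1 q) //= big1 => [|p pq].
  rewrite addr0 mxE /q; case: (ltngtP k l) => kl /=.
  - rewrite skewE /= -?ltnNge // eqxx xpair_eqE.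
    by rewrite -val_eqE /= (ltn_eqF kl) /= sub0r mulrN1 Ckl opprK.
  - rewrite skewE /= -?ltnNge // eqxx xpair_eqE.
    by rewrite -val_eqE /= (ltn_eqF kl) /= subr0 mulr1.
  - by rewrite (val_inj kl) Ckk mul0r.
rewrite mxE; have [p12|p12] := leqP p.1 p.2; first by rewrite skew0 ?mulr0.
rewrite skewE -?ltnNge //; have [pE|_] := eqVneq (k, l) p.
  by move: pq p12; rewrite -pE /q /= => + lk; rewrite leqNgt lk eqxx.
have [pE|_] := eqVneq (l, k) p; last by rewrite subr0 mulr0.
by move: pq p12; rewrite -pE /q /= => + kl; rewrite ltnW // eqxx.
Qed.

(** The corrections by E_(i0,i0) add up to tr A times E_(i0,i0), which vanishes; the omitted index
    (i0, i0) would contribute 0. *)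
Lemma sl_mx_span (i0 : 'I_t) (A : 'M[F]_t) :
  \tr A = 0 ->
  \sum_(p : {p in predC1 (i0, i0)}) A (val p).1 (val p).2 *: sl_mx i0 (val p) = A.
Proof.
move=> trA.
rewrite -(big_sub (predC1 (i0, i0)) (fun p => A p.1 p.2 *: sl_mx i0 p)).
have -> : \sum_(p in predC1 (i0, i0)) A p.1 p.2 *: sl_mx i0 p =
    \sum_p A p.1 p.2 *: sl_mx i0 p.
  rewrite [RHS](bigD1 (i0, i0)) //= /sl_mx eqxx scale1r subrr scaler0 add0r.
  by apply: eq_bigl => p; rewrite inE.
under eq_bigr do rewrite scalerBr scalerA.
rewrite sumrB -scaler_suml.
have -> : \sum_(p : 'I_t * 'I_t) A p.1 p.2 * (p.1 == p.2)%:R = \tr A.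
  rewrite -(pair_bigA _ (fun i j => A i j * (i == j)%:R)) /=.
  apply: eq_bigr => i _; rewrite (bigD1 i) //= eqxx mulr1 big1 ?addr0 // => j.
  by rewrite eq_sym => /negPf->; rewrite mulr0.
rewrite trA scale0r subr0 -(pair_bigA _ (fun i j => A i j *: delta_mx i j)) /=.
by rewrite [RHS]matrix_sum_delta.
Qed.

End SpanningMatrices.

(** * A homogeneous spanning family of b(t) and its total weight *)

Section BtBasis.
Variables (F : fieldType) (charF : [pchar F] =i pred0) (t : nat) (i0 : 'I_t).

(* Of the pairs (i, j) indexing the odd part, those with i <= j give the
   symmetric block B and those with i > j the skew block C.  In the even part,
   E_ij - delta_ij E_(i0,i0) is 0 for (i, j) = (i0, i0). *)
Definition bt_index := (('I_t * 'I_t) + {p in predC1 (i0, i0)})%type.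

Definition bt_basis_mx (u : bt_index) : 'M[F]_(t + t) :=
  match u with
  | inl p => block_mx 0 (sym_mx F p) (skew_mx F p) 0
  | inr p => block_mx (sl_mx F i0 (val p)) 0 0 (- (sl_mx F i0 (val p))^T)
  end.

Lemma bt_basis_mx_in u : bt_basis_mx u \in in_bt F t.
Proof.
apply/in_btP; case: u => p /=.
  exists 0, (sym_mx F p), (skew_mx F p).
  by rewrite trmx0 oppr0 sym_mx_tr skew_mx_tr mxtrace0.
by exists (sl_mx F i0 (val p)), 0, 0; rewrite trmx0 oppr0 sl_mx_tr.
Qed.

Definition bt_basis (u : bt_index) : bt charF t := Bt charF (bt_basis_mx_in u).

Definition bt_deg (u : bt_index) : int :=
  if u is inl p then (if (p.1 <= p.2)%N then 1 else -1) else 0.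

Lemma bt_basis_span (x : bt charF t) :
  exists c : bt_index -> F, x = \sum_u c u *: bt_basis u.
Proof.
have /in_btP[A [B [C [xE symB skewC trA]]]] := valP x.
(* For each odd index one of [sym_mx] and [skew_mx] is zero, so a single coefficient, taken from B
   or from C, serves both blocks. *)
exists (fun u : bt_index => match u with
  | inl p => if (p.1 <= p.2)%N then B p.1 p.2 else C p.1 p.2
  | inr p => A (val p).1 (val p).2 end).
apply: val_inj; rewrite raddf_sum /= big_sumType /= -[bt_mx x]/(val x) xE.
rewrite !sum_block_mx add_block_mx.
have sum0 (T : finType) (c : T -> F) : \sum_i c i *: (0 : 'M[F]_t) = 0.
  by rewrite big1 // => i _; rewrite scaler0.
rewrite !sum0 (sl_mx_span i0 trA) !add0r !addr0.
congr block_mx.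
- rewrite -[LHS](sym_mx_span symB); apply: eq_bigr => p _.
  by case: ifP => // p12; rewrite /sym_mx p12 !scaler0.
- rewrite -[LHS](skew_mx_span charF skewC); apply: eq_bigr => p _.
  by case: ifP => // p12; rewrite /skew_mx p12 !scaler0.
- rewrite -[in LHS](sl_mx_span i0 trA) linear_sum /= -sumrN.
  by apply: eq_bigr => p _; rewrite linearZ /= scalerN.
Qed.

Lemma bt_basis_homog u : mx_homog (bt_deg u) (bt_basis_mx u).
Proof.
case: u => p /=; apply: mx_homog_block => //.
  by rewrite /sym_mx; case: ifP.
by rewrite /skew_mx; case: ifP.
Qed.

Lemma codim_bt_le (R : realType) (z : R) (n : nat) : 0 < z ->
  (codim (bt charF t) n)%:R <=
  (\sum_p z ^ (- @entry_deg t p)) * (\sum_u z ^ bt_deg u) ^+ n.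
Proof.
pose coor (p : 'I_(t + t) * 'I_(t + t)) (x : bt charF t) := x p.1 p.2.
apply: (@codim_le_expr F _ _ _ bt_basis bt_deg coor).
- exact: bt_basis_span.
- by move=> p a x y; rewrite /coor /= !mxE.
- by move=> x x0; apply/val_inj/matrixP => i j; rewrite mxE; exact: (x0 (i, j)).
- by move=> u [i j]; exact: bt_basis_homog.
- move=> d e x y xd ye [i j]; apply: mx_homog_bracket => k l.
    exact: (xd (k, l)).
  exact: (ye (k, l)).
Qed.

(** Doubling clears the denominators in r z + q + p / z, where r = t(t+1)/2, q = t^2-1 and p =
    t(t-1)/2. *)
Lemma sum_bt_deg (R : realType) (z : R) :
  2 * \sum_u z ^ bt_deg u =
  t%:R ^+ 2 * (z + z^-1) + t%:R * (z - z^-1) + 2 * (t%:R ^+ 2 - 1).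
Proof.
rewrite big_sumType /= mulrDr; congr (_ + _); last first.
  under eq_bigr do rewrite expr0z.
  rewrite sumr_const card_sig.
  have := cardC1 (i0, i0); rewrite card_prod card_ord => E.
  congr (2 * _); transitivity (((t * t).-1)%:R : R); first by rewrite -E.
  have t0 : (0 < t * t)%N by rewrite muln_gt0 (leq_ltn_trans _ (ltn_ord i0)).
  by rewrite -subn1 natrB // natrM expr2.
pose w (p : 'I_t * 'I_t) := z ^ (if (p.1 <= p.2)%N then 1 else -1 : int).
rewrite mulr2n mulrDl mul1r -/w.
(* Adding the sum to its transpose symmetrizes the weight. *)
have -> : \sum_p w p + \sum_p w p = \sum_p (w p + w (p.2, p.1)).
  rewrite big_split /=; congr (_ + _).
  rewrite (reindex_inj (h := fun p => (p.2, p.1))) //.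
  by move=> [? ?] [? ?] [-> ->].
(* Off the diagonal a pair and its transpose have weights z and z^-1 in some order; on it both are
   z, and 2 z = (z + z^-1) + (z - z^-1). *)
transitivity (\sum_(p : 'I_t * 'I_t)
    (z + z^-1 + (p.1 == p.2)%:R * (z - z^-1))).
  apply: eq_bigr => -[i j] _; rewrite /w /= -val_eqE /=.
  case: ltngtP => _ /=; rewrite ?expr1z ?exprN1 ?mul0r ?mul1r ?addr0 //.
    by rewrite addrC.
  by rewrite addrACA subrr addr0.
rewrite big_split /= sumr_const card_prod card_ord -[_ *+ (t * t)]mulr_natl natrM.
congr (_ + _); rewrite -mulr_suml; congr (_ * _).
rewrite -(pair_bigA _ (fun i j => (i == j)%:R)) /=.
transitivity (\sum_(i < t) (1 : R)); last by rewrite sumr_const card_ord.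
apply: eq_bigr => i _; rewrite (bigD1 i) //= eqxx big1 ?addr0 // => j.
by rewrite eq_sym => /negPf->.
Qed.

End BtBasis.

(** * Choice of the weight z and the resulting bound *)

Theorem theorem2 (R : realType) (F : fieldType) (charF : [pchar F] =i pred0)
    (t : nat) (ht : (2 <= t)%N) :
  cvgn (codim_root R (bt charF t)) ->
  PIexp R (bt charF t)
    <= t%:R ^+ 2 - 1 + t%:R * Num.sqrt (t%:R ^+ 2 - 1).
Proof.
pose i0 : 'I_t := Ordinal (ltnW ht).
have t1 : 1 < t%:R :> R by rewrite ltr1n.
have t2 : 0 < t%:R ^+ 2 - 1 :> R by rewrite subr_gt0 expr2; nra.
set s : R := Num.sqrt _.
have s0 : 0 < s by rewrite sqrtr_gt0.
have s2 : s * s = t%:R ^+ 2 - 1 by rewrite -expr2 sqr_sqrtr // ltW.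
(* The minimizer sqrt(p / r) of r z + p / z. *)
pose z := s / (t%:R + 1).
have z0 : 0 < z by rewrite divr_gt0 //; lra.
have zV : z^-1 = s / (t%:R - 1).
  by rewrite invf_div; apply/eqP; rewrite eqr_div; [apply/eqP; nra| |]; lra.
(* At this z both r z and p / z equal t s / 2. *)
have sumE : \sum_(u : bt_index i0) z ^ bt_deg u = t%:R ^+ 2 - 1 + t%:R * s.
  apply: (@mulfI _ 2); first by rewrite pnatr_eq0.
  rewrite (sum_bt_deg i0 z) zV /z; field.
  by apply/andP; split; lra.
apply: (@PIexp_le _ _ _ (\sum_p z ^ (- @entry_deg t p))).
(* Any index will do: all summands of K are positive, and one index makes the sum nonempty. *)
- have i0' : 'I_(t + t) := lshift t i0.
  rewrite (bigD1 (i0', i0')) //= ltr_pwDl ?exprz_gt0 // sumr_ge0 // => p _.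
  by rewrite exprz_ge0 // ltW.
- by rewrite addr_ge0 ?mulr_ge0 // ltW.
- by move=> n; rewrite -sumE; exact: codim_bt_le.
Qed.
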